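(* Let $C,D\subseteq\mathbb{R}^n$ be convex sets whose relative interiors intersect, i.e. $\operatorname{rint}(C)\cap\operatorname{rint}(D)\neq\emptyset$. Then $$C\cup D\subseteq T_a(C,D),$$ where $T_a(C,D)$ is the affine joint supporting subspace of $C$ and $D$.
   Context: $\operatorname{rint}$ is the relative interior. $A\pm B=\{a\pm b\mid a\in A,b\in B\}$. Faces: for $C\subseteq\mathbb{R}^n$ convex, a subset $F\subseteq C$ is a face of $C$ if for all $y,z\in C$, whenever the open segment $]y,z[ = [y,z]\setminus\{y,z\}$ meets $F$, both $y,z\in F$. For $S\subseteq C$, $F_C(S)$ denotes the smallest face of $C$ containing $S$; $F_C(x)=F_C(\{x\})$. Joint supporting subspace: for convex $C,D\subseteq\mathbb{R}^n$ with $C\cap D\neq\emptyset$, $T(C,D):=\operatorname{Span} F_{C-D}(0)$ (linear span) and $T_a(C,D):=T(C,D)+(C\cap D)$. *)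

(* Defs.v *)
From HB Require Import structures.
From mathcomp Require Import all_boot all_order all_algebra.
From mathcomp Require Import all_classical all_reals all_analysis.
Set Implicit Arguments.
Unset Strict Implicit.
Unset Printing Implicit Defensive.
Import Order.TTheory GRing.Theory Num.Theory.
Import numFieldNormedType.Exports.
Local Open Scope classical_set_scope.
Local Open Scope ring_scope.

Section Minkowski.
Context {V : zmodType}.
Implicit Types A B : set V.

Definition set_add A B : set V := [set a + b | a in A & b in B].

Definition set_sub A B : set V := [set a - b | a in A & b in B].

End Minkowski.

Section LinearAndAffine.
Context {R : numDomainType} {V : lmodType R}.
Implicit Types (S A : set V) (y z : V).

Definition segment y z : set V :=
  [set (1 - t) *: y + t *: z | t in [set t : R | 0 <= t <= 1]].

(* Empty when [y = z]. *)
Definition open_segment y z : set V := segment y z `\` [set y; z].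

Definition linear_span S : set V :=
  smallest [set W : set V | submod_closed (mem W)] S.

(* The empty set counts as affine, so that [affine_hull set0 = set0]. *)
Definition affine_set A : Prop :=
  forall x y (t : R), A x -> A y -> A ((1 - t) *: x + t *: y).

Definition affine_hull S : set V := smallest affine_set S.

End LinearAndAffine.

Section Faces.
Context {R : numDomainType} {V : lmodType R}.
Implicit Types (C F S : set V).

(* Faces are not required to be convex, and [set0] is a face. *)
Definition is_face C F : Prop :=
  F `<=` C /\
  forall y z, C y -> C z -> open_segment y z `&` F !=set0 -> F y /\ F z.

(* Meaningful for [S `<=` C] only: otherwise no face of [C] contains [S]. *)
Definition smallest_face C S : set V := smallest (is_face C) S.

Lemma is_face_smallest_face C S : S `<=` C -> is_face C (smallest_face C S).
Proof.
move=> SC; have CC : is_face C C by split.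
split=> [x|y z Cy Cz [x [yzx Fx]]]; first exact.
by split=> F [CF SF]; have [] := CF.2 y z Cy Cz; try (exists x; split=> //; exact: Fx).
Qed.

End Faces.

Section JointSupport.
Context {R : realType} {n : nat}.
Implicit Types C D : set 'rV[R]_n.

(* In the topology of [subspace A] the points outside [A] are isolated; since
   [C `<=` affine_hull C], this interior is the interior of [C] in the
   topology induced on [affine_hull C]. *)
Definition rint C : set 'rV[R]_n :=
  interior (C : set (subspace (affine_hull C))).

Lemma rintP C x :
  rint C x <-> affine_hull C x /\ within (affine_hull C) (nbhs x) C.
Proof.
split=> [Cx|[Ax ACx]]; last by move: ACx; rewrite (nbhs_subspace_in Ax).
have Ax : affine_hull C x by apply: sub_gen_smallest; exact: nbhs_singleton Cx.
by split=> //; rewrite (nbhs_subspace_in Ax).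
Qed.

(* T(C, D) *)
Definition joint_supporting_subspace C D : set 'rV[R]_n :=
  linear_span (smallest_face (set_sub C D) [set 0]).

(* T_a(C, D) *)
Definition affine_joint_supporting_subspace C D : set 'rV[R]_n :=
  set_add (joint_supporting_subspace C D) (C `&` D).

End JointSupport.

(* Main.v *)
Require Import Defs.
From mathcomp Require Import all_boot all_order all_algebra.
From mathcomp Require Import all_classical all_reals all_analysis.
From mathcomp Require Import ring lra.
Import Order.TTheory GRing.Theory Num.Theory.
Import numFieldNormedType.Exports.
Local Open Scope classical_set_scope.
Local Open Scope ring_scope.

(** Fix a common point [x] of the two relative interiors. A segment of [C]
    ending at [x] can be prolonged slightly beyond [x] inside [C]
    ([rint_prolong]). So for [y] in [C] other than [x], the vector [y - x] and
    a negative multiple of it both belong to [set_sub C D], and [0] lies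
    strictly between them: every face of [set_sub C D] through [0] must
    contain [y - x] ([smallest_face0_opposite]). Writing [y = (y - x) + x]
    with [x] in [C `&` D] concludes. For [y] in [D] the same argument puts
    [x - y] in the face, and the linear span also contains its opposite
    [y - x]. *)

Lemma rint_sub {R : realType} {n : nat} {C : set 'rV[R]_n} : rint C `<=` C.
Proof. by move=> x /rintP[Ax /nbhs_singleton]; apply. Qed.

(** The line through [x] and [y] stays in the affine hull of [C], relative to
    which [C] is a neighbourhood of [x]. *)
Lemma rint_prolong {R : realType} {n : nat} {C : set 'rV[R]_n} {x y} :
  rint C x -> C y -> exists2 e : R, 0 < e & C (x + e *: (x - y)).
Proof.
move=> /rintP[Ax Cx] Cy.
have line_cvg : (fun e : R => x + e *: (x - y)) @ 0^'+ --> x.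
  rewrite -[X in _ --> X]addr0 -(scale0r (x - y)).
  apply: cvgD; first exact: cvg_cst.
  by apply: cvgZr_tmp; exact: cvg_at_right_filter cvg_id.
have line_hull e : affine_hull C (x + e *: (x - y)).
  have -> : x + e *: (x - y) = (1 - - e) *: x + (- e) *: y.
    by rewrite opprK scalerDl scale1r scalerBr scaleNr addrA.
  by move=> A affCA; apply: (affCA.1); [exact: Ax | exact: affCA.2].
have near0C : \forall e \near 0^'+, C (x + e *: (x - y)).
  have : \forall e \near 0^'+, affine_hull C (x + e *: (x - y)) ->
      C (x + e *: (x - y)).
    exact: line_cvg Cx.
  by apply: filterS => e; apply; exact: line_hull.
have near0_gt0 : \forall e \near 0^'+, (0 : R) < e by exact: nbhs_right_gt.
by have [e [e0 Ce]] := filter_ex (filterI near0_gt0 near0C); exists e.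
Qed.

(** The face property applied to the segment from [v] to [- (e *: v)], which
    crosses [0]; this segment degenerates when [v = 0], but then [v] is the
    point that the face contains by assumption. *)
Lemma smallest_face0_opposite {R : realFieldType} {V : lmodType R} {K : set V}
    {v : V} {e : R} :
  0 < e -> K v -> K (- (e *: v)) -> smallest_face K [set 0] v.
Proof.
move=> e0 Kv Kev F [[_ faceF] F0].
have [->|v0] := eqVneq v 0; first exact: F0.
suff : open_segment v (- (e *: v)) 0.
  by move=> seg0; case: (faceF _ _ Kv Kev) => //; exists 0; split=> //; exact: F0.
have e1 : 0 < 1 + e by lra.
split.
  (* the weight at which [1 - t] and [t * e] balance *)
  exists (1 + e)^-1.
    by rewrite /= invr_ge0 ltW //= invf_le1 //; lra.
  rewrite scalerN scalerA -scalerBl.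
  have -> : 1 - (1 + e)^-1 - (1 + e)^-1 * e = 0 by field; exact: lt0r_neq0.
  exact: scale0r.
case=> /esym/eqP; first by apply/negP.
by rewrite oppr_eq0 scaler_eq0 (negPf v0) (gt_eqF e0).
Qed.

Lemma linear_spanN (R : numDomainType) (V : lmodType R) (S : set V) v :
  linear_span S v -> linear_span S (- v).
Proof.
move=> Sv W [subW SW]; have [W0 linW] := subW.
have /mem_set Wv : W v by apply: Sv.
have := linW (-1) v 0 Wv W0.
by rewrite scaleN1r addr0 => /set_mem.
Qed.

Theorem proposition5p1 (R : realType) (n : nat) (C D : set 'rV[R]_n)
    (convC : convex_set (C : set (convex_lmodType 'rV[R]_n)))
    (convD : convex_set (D : set (convex_lmodType 'rV[R]_n)))
    (rint_meet : rint C `&` rint D !=set0) :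
  C `|` D `<=` affine_joint_supporting_subspace C D.
Proof.
have [x [rCx rDx]] := rint_meet.
have Cx := rint_sub _ rCx; have Dx := rint_sub _ rDx.
move=> y CDy.
suff Ty : joint_supporting_subspace C D (y - x).
  by exists (y - x) => //; exists x => //; rewrite subrK.
case: CDy => [Cy|Dy].
  have [e e0 Ce] := rint_prolong rCx Cy.
  apply: sub_gen_smallest; apply: (smallest_face0_opposite e0).
    by exists y => //; exists x.
  exists (x + e *: (x - y)) => //; exists x => //.
  by rewrite addrC addKr -scalerN opprB.
have [e e0 De] := rint_prolong rDx Dy.
rewrite -opprB; apply: linear_spanN.
apply: sub_gen_smallest; apply: (smallest_face0_opposite e0).
  by exists x => //; exists y.
exists x => //; exists (x + e *: (x - y)) => //.
by rewrite opprD addNKr.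
Qed.
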